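(* Let $(B_0,B_1)$ and $(C_0,C_1)$ be interpolation couples compatible with $(\Omega,\Sigma,\mu,(\Delta_0,\Delta_1))$ and $(\Omega,\Sigma,\mu,(\Delta_2,\Delta_3))$ respectively, let $\theta\in(0,1)$, and let $T_j:B_j\to C_j$, $j\in\{0,1\}$, be bounded operators with $T_0|_{B_0\cap B_1}=T_1|_{B_0\cap B_1}$; denote by $T$ the induced operator on $B_0+B_1$. Suppose that $T:B_0\to C_0$ is absolutely continuous. Then $T:B_\theta\to C_\theta$ is absolutely continuous.
   Context: All Banach spaces are complex; $(\Omega,\Sigma,\mu)$ is a measure space. A Banach space $Y$ is a function space in the wide sense on $(\Omega,\Sigma,\mu,\Delta_Y)$ if $\Delta_Y:\Sigma\times Y\to Y$ satisfies: (I) $\Delta_Y(A\cap B,f)=\Delta_Y(A,\Delta_Y(B,f))$ for all $A,B\in\Sigma$, $f\in Y$; (II) $f\mapsto\Delta_Y(A,f)$ is linear for each $A\in\Sigma$; (III) $\Delta_Y(A\cup B,f)=\Delta_Y(A,f)+\Delta_Y(B,f)$ if $A\cap B=\emptyset$; (IV) $\Delta_Y(A,f)=0$ if $\mu(A)=0$, and $\Delta_Y(\Omega,f)=f$; (V) there is $C>0$ with $\|\Delta_Y(A,f)\|\le C\|f\|$ for all $A,f$. A bounded operator $T:X\to Z$ from a function space in the wide sense $X$ to a Banach space $Z$ is absolutely continuous if for every $\varepsilon>0$ there is $\delta>0$ such that for every $A\in\Sigma$ with $\mu(A)<\delta$, the operator $f\mapsto T(\Delta_X(A,f))$ has norm $<\varepsilon$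 in $\mathcal L(X,Z)$. An interpolation couple $(B_0,B_1)$ is compatible with $(\Omega,\Sigma,\mu,(\Delta_0,\Delta_1))$ if each $B_j$ is a function space in the wide sense on $(\Omega,\Sigma,\mu,\Delta_j)$ and $\Delta_0(A,f)=\Delta_1(A,f)$ for all $A\in\Sigma$, $f\in B_0\cap B_1$. Then $(\Delta_0+\Delta_1)(A,f_0+f_1)=\Delta_0(A,f_0)+\Delta_1(A,f_1)$ ($f_j\in B_j$) is well defined on $B_0+B_1$. $B_\theta=(B_0,B_1)_\theta$ is the (first) complex interpolation space: with $S=\{0\le\operatorname{Re}z\le1\}$, $\mathcal F(B_0,B_1)$ is the space of bounded continuous $F:S\to B_0+B_1$, holomorphic in the interior, such that for $j=0,1$ $\tau\mapsto F(j+i\tau)$ is continuous into $B_j$ with $\|F(j+i\tau)\|_{B_j}\to0$ as $|\tau|\to\infty$, normed by $\max_j\sup_\tau\|F(j+i\tau)\|_{B_j}$; $B_\theta=\{F(\theta):F\in\mathcal F(B_0,B_1)\}$ with the quotient norm. It is a function space in the wide sense with $\Delta_\theta=(\Delta_0+\Delta_1)|_{\Sigma\times B_\theta}$. $C_\theta=(C_0,C_1)_\theta$ is defined in the same way. *)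

(* Defs.v *)
From HB Require Import structures.
From mathcomp Require Import all_boot all_order all_algebra.
From mathcomp Require Import complex.
From mathcomp Require Import all_classical all_reals all_analysis.

Set Implicit Arguments.
Unset Strict Implicit.
Unset Printing Implicit Defensive.

Import Order.TTheory GRing.Theory Num.Theory.
Import numFieldNormedType.Exports.

Local Open Scope classical_set_scope.
Local Open Scope ring_scope.

(* The norm topology of the library is attached to the sort of an abstract
   numFieldType, hence the cast of R[i]. *)
Definition Cx (R : realType) : numFieldType := R[i].

(* The library's norm on a module over R[i] takes values in R[i]. *)
Definition rnorm (R : realType) (X : normedModType (Cx R)) (x : X) : R :=
  complex.Re `|x|.

Section Operators.
Context (R : realType).

(* The norms are explicit parameters because these notions are used both for
   Banach spaces (with rnorm) and for interpolation spaces (with interp_norm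
   below). *)
Definition bounded_op (X Z : lmodType (Cx R)) (nX : X -> R) (nZ : Z -> R)
    (T : X -> Z) : Prop :=
  linear T /\ exists M : R, forall f, nZ (T f) <= M * nX f.

Definition opnorm (X Z : lmodType (Cx R)) (nX : X -> R) (nZ : Z -> R)
    (T : X -> Z) : \bar R :=
  ereal_sup [set (nZ (T f))%:E | f in [set f | nX f <= 1]].

Definition absolutely_continuous (d : measure_display) (Omega : measurableType d)
    (mu : {measure set Omega -> \bar R}) (X Z : lmodType (Cx R))
    (nX : X -> R) (nZ : Z -> R) (Delta : set Omega -> X -> X) (T : X -> Z) :
    Prop :=
  bounded_op nX nZ T /\
  forall eps : R, 0 < eps -> exists2 delta : R, 0 < delta &
    forall A, measurable A -> (mu A < delta%:E)%E ->
      (opnorm nX nZ (fun f => T (Delta A f)) < eps%:E)%E.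

(* Delta is only constrained on measurable sets, so it stands for a map
   Sigma * Y -> Y. *)
Record wide_function_space (d : measure_display) (Omega : measurableType d)
    (mu : {measure set Omega -> \bar R}) (Y : completeNormedModType (Cx R))
    (Delta : set Omega -> Y -> Y) : Prop := WideFunctionSpace {
  wide_setI : forall A B f, measurable A -> measurable B ->
    Delta (A `&` B) f = Delta A (Delta B f);
  wide_linear : forall A, measurable A -> linear (Delta A);
  wide_setU : forall A B f, measurable A -> measurable B -> A `&` B = set0 ->
    Delta (A `|` B) f = Delta A f + Delta B f;
  wide_null : forall A f, measurable A -> mu A = 0%E -> Delta A f = 0;
  wide_setT : forall f, Delta setT f = f;
  wide_bounded : exists2 C : R, 0 < C &
    forall A f, measurable A -> rnorm (Delta A f) <= C * rnorm f
}.

End Operators.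

(* Two Banach spaces continuously embedded in a Hausdorff topological vector
   space; elements of end0 and end1 are identified when their embeddings in
   ambient agree. *)
Record interp_couple (R : realType) := InterpCouple {
  ambient : topologicalLmodType (Cx R);
  end0 : completeNormedModType (Cx R);
  end1 : completeNormedModType (Cx R);
  emb0 : {linear end0 -> ambient};
  emb1 : {linear end1 -> ambient};
  ambient_hausdorff : hausdorff_space ambient;
  emb0_inj : injective emb0;
  emb1_inj : injective emb1;
  emb0_continuous : continuous emb0;
  emb1_continuous : continuous emb1
}.
Arguments emb0 {R} i.
Arguments emb1 {R} i.

Section Rnorm.
Context (R : realType).
Implicit Types X Z : normedModType (Cx R).

Lemma rnormE X (x : X) : `|x| = ((rnorm x)%:C)%C.
Proof.
have : `|x| \is Num.real by exact: normr_real.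
by move/complex_realP => [r rE]; rewrite /rnorm rE.
Qed.

Lemma rnorm_ge0 X (x : X) : 0 <= rnorm x.
Proof. by have := normr_ge0 x; rewrite rnormE -(rmorph0 (real_complex R)) lecR. Qed.

Lemma rnormD X (x y : X) : rnorm (x + y) <= rnorm x + rnorm y.
Proof. by have := ler_normD x y; rewrite !rnormE -rmorphD lecR. Qed.

Lemma rnormZ X (a : Cx R) (x : X) : rnorm (a *: x) = rnorm a * rnorm x.
Proof. by have := normrZ a x; rewrite !rnormE -rmorphM => /complexI. Qed.

Lemma rnorm0 X : rnorm (0 : X) = 0.
Proof. by rewrite /rnorm normr0. Qed.

Lemma rnorm_eq0 X (x : X) : rnorm x = 0 -> x = 0.
Proof. by move=> x0; apply/normr0_eq0; rewrite rnormE x0. Qed.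

Lemma bounded_op_continuous X Z (T : X -> Z) :
  bounded_op (@rnorm R X) (@rnorm R Z) T -> continuous T.
Proof.
move=> [linT [M TM]] x; apply/cvgrPdist_lt => e e0.
have TB y z : T (y - z) = T y - T z.
  by rewrite addrC -scaleN1r linT scaleN1r addrC.
have M0 : 0 < `|M| + 1 by rewrite ltr_pwDr.
have M0C : 0 < ((`|M| + 1)%:C)%C :> Cx R.
  by rewrite -(rmorph0 (real_complex R)) ltcR.
near=> y; rewrite -TB; apply: (@le_lt_trans _ _ (((`|M| + 1)%:C)%C * `|x - y|)).
  rewrite !rnormE -rmorphM lecR; apply: (le_trans (TM _)).
  rewrite ler_wpM2r ?rnorm_ge0//; apply: (le_trans (ler_norm _)).
  by rewrite lerDl.
rewrite mulrC -ltr_pdivlMr//; near: y.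
by apply: cvgr_dist_lt => //; rewrite divr_gt0.
Unshelve. all: by end_near. Qed.

Lemma rnorm_continuous X : continuous (@rnorm R X).
Proof.
have rB (x y : X) : rnorm x - rnorm y <= rnorm (x - y).
  by rewrite lerBlDr; apply: le_trans (rnormD _ _); rewrite subrK.
move=> x; apply/cvgrPdist_lt => e e0; near=> y.
apply: (@le_lt_trans _ _ (rnorm (x - y))).
  rewrite ler_norml rB andbT lerNl opprB; apply: (le_trans (rB _ _)).
  by rewrite /rnorm distrC.
rewrite -ltcR -rnormE; near: y; apply: cvgr_dist_lt => //.
by rewrite -(rmorph0 (real_complex R)) ltcR.
Unshelve. all: by end_near. Qed.

Lemma has_sup_rnorm X (u : R -> X) : continuous u ->
  rnorm (u t) @[t --> +oo] --> (0 : R) -> rnorm (u t) @[t --> -oo] --> (0 : R) ->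
  has_sup [set rnorm (u t) | t in setT].
Proof.
move=> cu up un; split; first by exists (rnorm (u 0)), 0.
have [b [_ /= ub]] : \forall t \near +oo, rnorm (u t) < 1.
  by apply: (cvgr_lt 0).
have [a [_ /= ua]] : \forall t \near -oo, rnorm (u t) < 1.
  by apply: (cvgr_lt 0).
pose c := `|a| + `|b| + 1.
have c0 : - c <= c by rewrite -subr_ge0 opprK addr_ge0 ?addr_ge0.
have [|m _ mP] := @EVT_max R (@rnorm R X \o u) (- c) c c0.
  apply: continuous_subspaceT => t; apply: continuous_comp; first exact: cu.
  exact: rnorm_continuous.
exists (Num.max 1 (rnorm (u m))) => _ [t _ <-]; rewrite le_max.
have [tc|tc] := ltP c t.
  rewrite (ltW (ub _ _))//; apply: le_lt_trans tc; apply: (le_trans (ler_norm _)).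
  by rewrite /c addrAC lerDr addr_ge0.
have [ct|ct] := ltP t (- c).
  rewrite (ltW (ua _ _))//; apply: (lt_le_trans ct).
  rewrite lerNl; apply: (le_trans (ler_norm _)).
  by rewrite normrN /c -addrA lerDl addr_ge0.
by rewrite [X in _ || X](mP t) ?orbT// in_itv /= ct tc.
Qed.

End Rnorm.

Section SumSpace.
Context (R : realType) (B : interp_couple R).

Definition sum_pred : {pred ambient B} := fun v =>
  `[< exists f0 f1, v = emb0 B f0 + emb1 B f1 >].

Lemma sum_pred_closed : submod_closed sum_pred.
Proof.
split; first by apply/asboolP; exists 0, 0; rewrite !linear0 addr0.
move=> a u v /asboolP[u0 [u1 ->]] /asboolP[v0 [v1 ->]]; apply/asboolP.
by exists (a *: u0 + v0), (a *: u1 + v1); rewrite !linearP scalerDr addrACA.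
Qed.

HB.instance Definition _ :=
  GRing.isSubmodClosed.Build (Cx R) (ambient B) sum_pred sum_pred_closed.

(* B_0 + B_1, with norm inf (|f0| + |f1|) over the decompositions f0 + f1. *)
Record sum_space := SumSpace {
  sum_val : ambient B;
  _ : sum_val \in sum_pred
}.

HB.instance Definition _ := [isSub for sum_val].
HB.instance Definition _ := [Choice of sum_space by <:].
HB.instance Definition _ := [SubChoice_isSubLmodule of sum_space by <:].

Definition sum_norm (v : sum_space) : R :=
  inf [set r | exists f0 f1,
         sum_val v = emb0 B f0 + emb1 B f1 /\ r = rnorm f0 + rnorm f1].

Lemma sum_valP (v : sum_space) :
  exists f0 f1, sum_val v = emb0 B f0 + emb1 B f1.
Proof. by case: v => v /= /asboolP. Qed.

Lemma sum_norm_le (v : sum_space) f0 f1 :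
  sum_val v = emb0 B f0 + emb1 B f1 -> sum_norm v <= rnorm f0 + rnorm f1.
Proof.
move=> vE; apply: ge_inf; last by exists f0, f1.
by exists 0 => _ [g0 [g1 [_ ->]]]; rewrite addr_ge0 ?rnorm_ge0.
Qed.

Lemma le_sum_norm (v : sum_space) c :
  (forall f0 f1, sum_val v = emb0 B f0 + emb1 B f1 ->
     c <= rnorm f0 + rnorm f1) -> c <= sum_norm v.
Proof.
move=> H; have [f0 [f1 vE]] := sum_valP v.
apply: lb_le_inf; first by exists (rnorm f0 + rnorm f1), f0, f1.
by move=> _ [g0 [g1 [gE ->]]]; apply: H.
Qed.

Lemma sum_norm_lt (v : sum_space) c : sum_norm v < c ->
  exists f0 f1, sum_val v = emb0 B f0 + emb1 B f1 /\ rnorm f0 + rnorm f1 < c.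
Proof.
apply: contraPP => H; apply/negP; rewrite -leNgt; apply: le_sum_norm => f0 f1 E.
by rewrite leNgt; apply/negP => lt; apply: H; exists f0, f1.
Qed.

Lemma sum_norm_ge0 (v : sum_space) : 0 <= sum_norm v.
Proof. by apply: le_sum_norm => f0 f1 _; rewrite addr_ge0 ?rnorm_ge0. Qed.

Lemma sum_normD (u v : sum_space) : sum_norm (u + v) <= sum_norm u + sum_norm v.
Proof.
rewrite -lerBlDr; apply: le_sum_norm => u0 u1 uE; rewrite lerBlDr -lerBlDl.
apply: le_sum_norm => v0 v1 vE; rewrite lerBlDl.
apply: (@le_trans _ _ (rnorm (u0 + v0) + rnorm (u1 + v1))).
  by apply: sum_norm_le; rewrite !linearD addrACA -uE -vE.
by rewrite addrACA lerD ?rnormD.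
Qed.

Lemma sum_normZ_le (a : Cx R) (v : sum_space) :
  sum_norm (a *: v) <= rnorm a * sum_norm v.
Proof.
have [->|a0] := eqVneq a 0.
  rewrite scale0r rnorm0 mul0r -[leRHS](addr0 0) -{1}(rnorm0 (end0 B)).
  rewrite -(rnorm0 (end1 B)); apply: sum_norm_le.
  by rewrite !linear0 addr0.
have ra : 0 < rnorm a.
  rewrite lt_neqAle rnorm_ge0 andbT eq_sym; apply/eqP => /rnorm_eq0 E.
  by rewrite E eqxx in a0.
rewrite mulrC -ler_pdivrMr//; apply: le_sum_norm => f0 f1 E.
rewrite ler_pdivrMr// mulrDl ![_ * rnorm a]mulrC -!rnormZ; apply: sum_norm_le.
by rewrite !linearZ -scalerDr -E.
Qed.

Lemma sum_normZ (a : Cx R) (v : sum_space) :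
  sum_norm (a *: v) = rnorm a * sum_norm v.
Proof.
apply/le_anti; rewrite sum_normZ_le /=.
have [->|a0] := eqVneq a 0; first by rewrite rnorm0 mul0r sum_norm_ge0.
have ra : 0 < rnorm a.
  rewrite lt_neqAle rnorm_ge0 andbT eq_sym; apply/eqP => /rnorm_eq0 E.
  by rewrite E eqxx in a0.
have := sum_normZ_le a^-1 (a *: v); rewrite scalerA mulVf// scale1r.
move=> /(ler_wpM2l (ltW ra)) /le_trans; apply.
rewrite mulrA -[X in _ <= X]mul1r ler_wpM2r ?sum_norm_ge0//.
by rewrite -(rnormZ a (a^-1 : Cx R)) /GRing.scale /= mulfV// /rnorm normr1.
Qed.

Lemma sum_norm_eq0 (v : sum_space) : sum_norm v = 0 -> v = 0.
Proof.
move=> v0; apply: val_inj => /=; apply/esym; apply: (@ambient_hausdorff R B).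
move=> U V U0 Vv; exists (sum_val v); split; last exact: nbhs_singleton.
have cvgE : (emb0 B p.1 + emb1 B p.2) @[p --> (0 : end0 B, 0 : end1 B)] -->
    (0 : ambient B).
  rewrite -[X in _ --> X](addr0 0) -{1}(linear0 (emb0 B)) -(linear0 (emb1 B)).
  have c0 : emb0 B p.1 @[p --> (0 : end0 B, 0 : end1 B)] --> emb0 B 0.
    by apply: (cvg_comp fst (emb0 B)); [exact: cvg_fst|exact: emb0_continuous].
  have c1 : emb1 B p.2 @[p --> (0 : end0 B, 0 : end1 B)] --> emb1 B 0.
    by apply: (cvg_comp snd (emb1 B)); [exact: cvg_snd|exact: emb1_continuous].
  exact: (cvg_comp _ _ (cvg_pair c0 c1) (@add_continuous _ (_, _))).
have [[P0 P1] /= [/nbhs_ballP[e0 /= e00 b0] /nbhs_ballP[e1 /= e10 b1]] PU] :=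
  cvgE U U0.
have [e [e_gt0 ee0 ee1]] : exists e : R,
    [/\ 0 < e, ((e%:C)%C : Cx R) <= e0 & ((e%:C)%C : Cx R) <= e1].
  have re (x : Cx R) : 0 < x -> exists2 r : R, 0 < r & x = ((r%:C)%C : Cx R).
    move=> x0; have /complex_realP[r xE] := gtr0_real x0.
    by exists r => //; move: x0; rewrite xE -(rmorph0 (real_complex R)) ltcR.
  have [r0 r00 ->] := re _ e00; have [r1 r10 ->] := re _ e10.
  exists (Num.min r0 r1); rewrite lt_min r00 r10; split => //.
    by rewrite lecR ge_min lexx.
  by rewrite lecR ge_min lexx orbT.
have /sum_norm_lt[f0 [f1 [-> lt]]] : sum_norm v < e by rewrite v0.
apply: (PU (f0, f1)); split => /=.
  apply: b0; rewrite -ball_normE /ball_ /= sub0r normrN rnormE.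
  apply: lt_le_trans ee0; rewrite ltcR; apply: le_lt_trans lt.
  by rewrite lerDl rnorm_ge0.
apply: b1; rewrite -ball_normE /ball_ /= sub0r normrN rnormE.
apply: lt_le_trans ee1; rewrite ltcR; apply: le_lt_trans lt.
by rewrite lerDr rnorm_ge0.
Qed.

Let sum_cnorm (v : sum_space) : Cx R := ((sum_norm v)%:C)%C.

Let sum_cnormD u v : sum_cnorm (u + v) <= sum_cnorm u + sum_cnorm v.
Proof. by rewrite /sum_cnorm -rmorphD lecR sum_normD. Qed.

Let sum_cnormZ (a : Cx R) v : sum_cnorm (a *: v) = `|a| * sum_cnorm v.
Proof. by rewrite /sum_cnorm sum_normZ rnormE -rmorphM. Qed.

Let sum_cnorm_eq0 v : sum_cnorm v = 0 -> v = 0.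
Proof. by move=> /complexI /sum_norm_eq0. Qed.

HB.instance Definition _ := @Lmodule_isNormed.Build (Cx R) sum_space
  sum_cnorm sum_cnormD sum_cnormZ sum_cnorm_eq0.

Lemma rnorm_sum (v : sum_space) : rnorm v = sum_norm v.
Proof. by []. Qed.

End SumSpace.

Section ComplexInterpolation.
Context (R : realType) (B : interp_couple R).

(* F belongs to the Calderon space F(B_0, B_1); F0 and F1 are its boundary
   values t |-> F (j + i t) seen as functions into B_j, which F determines since
   emb0 and emb1 are injective. Values of F off the closed strip are junk. *)
Record calderon (F : Cx R -> sum_space B) (F0 : R -> end0 B) (F1 : R -> end1 B) :
    Prop := Calderon {
  calderon_bounded : exists M : R, forall z : Cx R,
    0 <= complex.Re z <= 1 -> rnorm (F z) <= M;
  calderon_continuous :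
    {within [set z : Cx R | 0 <= complex.Re z <= 1], continuous F};
  calderon_holomorphic : forall z : Cx R,
    0 < complex.Re z < 1 -> derivable F z 1;
  calderon_trace0 : forall t, sum_val (F (0 +i* t)%C) = emb0 B (F0 t);
  calderon_trace1 : forall t, sum_val (F (1 +i* t)%C) = emb1 B (F1 t);
  calderon_trace0_continuous : continuous F0;
  calderon_trace1_continuous : continuous F1;
  calderon_trace0_pinfty : rnorm (F0 t) @[t --> +oo] --> (0 : R);
  calderon_trace0_ninfty : rnorm (F0 t) @[t --> -oo] --> (0 : R);
  calderon_trace1_pinfty : rnorm (F1 t) @[t --> +oo] --> (0 : R);
  calderon_trace1_ninfty : rnorm (F1 t) @[t --> -oo] --> (0 : R)
}.

(* The suprema are finite: see has_sup_rnorm. *)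
Definition calderon_norm (F0 : R -> end0 B) (F1 : R -> end1 B) : R :=
  Num.max (sup [set rnorm (F0 t) | t in setT]) (sup [set rnorm (F1 t) | t in setT]).

Definition interp_pred (theta : R) : {pred sum_space B} := fun f =>
  `[< exists F F0 F1, calderon F F0 F1 /\ F (theta%:C)%C = f >].

Lemma calderon0 : calderon (fun=> 0) (fun=> 0) (fun=> 0).
Proof.
split.
- by exists 0 => z _; rewrite rnorm0.
- by move=> z; exact: cvg_cst.
- by move=> z _; exact: derivable_cst.
- by move=> t; rewrite linear0.
- by move=> t; rewrite linear0.
- by move=> t; exact: cvg_cst.
- by move=> t; exact: cvg_cst.
- by rewrite rnorm0; exact: cvg_cst.
- by rewrite rnorm0; exact: cvg_cst.
- by rewrite rnorm0; exact: cvg_cst.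
- by rewrite rnorm0; exact: cvg_cst.
Qed.

Lemma rnorm_cvg0_le (X : normedModType (Cx R)) (G : set_system R)
    (FG : Filter G) (u : R -> X) (v : R -> R) :
  (forall t, rnorm (u t) <= v t) -> v t @[t --> G] --> (0 : R) ->
  rnorm (u t) @[t --> G] --> (0 : R).
Proof.
move=> uv v0; apply: (@squeeze_cvgr _ _ _ _ (fun=> 0) v) => //.
  by apply: nearW => t; rewrite rnorm_ge0 uv.
exact: cvg_cst.
Qed.

Lemma calderonP a F F0 F1 G G0 G1 :
  calderon F F0 F1 -> calderon G G0 G1 ->
  calderon (fun z => a *: F z + G z) (fun t => a *: F0 t + G0 t)
    (fun t => a *: F1 t + G1 t).
Proof.
move=> HF HG.
have lim (X : normedModType (Cx R)) (u v : R -> X) (H : set_system R)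
    (FH : Filter H) : rnorm (u t) @[t --> H] --> (0 : R) ->
    rnorm (v t) @[t --> H] --> (0 : R) ->
    rnorm (a *: u t + v t) @[t --> H] --> (0 : R).
  move=> u0 v0; apply: (@rnorm_cvg0_le _ _ _ _
    (fun t => rnorm (a : Cx R) * rnorm (u t) + rnorm (v t))).
    by move=> t; rewrite -rnormZ rnormD.
  rewrite -[X in _ --> X](addr0 (0 : R)) -{1}(mulr0 (rnorm (a : Cx R))).
  by apply: cvgD => //; apply: cvgMr.
split.
- have [M FM] := calderon_bounded HF; have [N GN] := calderon_bounded HG.
  exists (rnorm (a : Cx R) * M + N) => z zS; apply: (le_trans (rnormD _ _)).
  by rewrite rnormZ lerD ?GN// ler_wpM2l ?rnorm_ge0 ?FM.
- move=> z; apply: cvgD; last exact: (calderon_continuous HG).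
  by apply: cvgZr; exact: (calderon_continuous HF).
- move=> z zS; apply: derivableD; last exact: (calderon_holomorphic HG).
  by apply: derivableZ; exact: (calderon_holomorphic HF).
- by move=> t; rewrite linearP -(calderon_trace0 HF) -(calderon_trace0 HG).
- by move=> t; rewrite linearP -(calderon_trace1 HF) -(calderon_trace1 HG).
- move=> t; apply: cvgD; last exact: (calderon_trace0_continuous HG).
  by apply: cvgZr; exact: (calderon_trace0_continuous HF).
- move=> t; apply: cvgD; last exact: (calderon_trace1_continuous HG).
  by apply: cvgZr; exact: (calderon_trace1_continuous HF).
- exact: lim (calderon_trace0_pinfty HF) (calderon_trace0_pinfty HG).
- exact: lim (calderon_trace0_ninfty HF) (calderon_trace0_ninfty HG).
- exact: lim (calderon_trace1_pinfty HF) (calderon_trace1_pinfty HG).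
- exact: lim (calderon_trace1_ninfty HF) (calderon_trace1_ninfty HG).
Qed.

Lemma interp_pred_closed theta : submod_closed (interp_pred theta).
Proof.
split; first by apply/asboolP; exists (fun=> 0), (fun=> 0), (fun=> 0);
  split; [exact: calderon0|].
move=> a u v /asboolP[F [F0 [F1 [HF <-]]]] /asboolP[G [G0 [G1 [HG <-]]]].
apply/asboolP; exists (fun z => a *: F z + G z), (fun t => a *: F0 t + G0 t),
  (fun t => a *: F1 t + G1 t); split => //.
exact: calderonP.
Qed.

HB.instance Definition _ theta := GRing.isSubmodClosed.Build (Cx R) (sum_space B)
  (interp_pred theta) (interp_pred_closed theta).

Record interp_space (theta : R) := InterpSpace {
  interp_val : sum_space B;
  _ : interp_val \in interp_pred theta
}.

HB.instance Definition _ theta := [isSub for @interp_val theta].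
HB.instance Definition _ theta := [Choice of interp_space theta by <:].
HB.instance Definition _ theta :=
  [SubChoice_isSubLmodule of interp_space theta by <:].

Definition interp_norm (theta : R) (f : interp_space theta) : R :=
  inf [set r | exists F F0 F1, [/\ calderon F F0 F1,
         F (theta%:C)%C = interp_val f & r = calderon_norm F0 F1]].

Lemma interp_valP (theta : R) (f : interp_space theta) :
  exists F F0 F1, calderon F F0 F1 /\ F (theta%:C)%C = interp_val f.
Proof. by case: f => f /= /asboolP. Qed.

Definition sum_mk (f0 : end0 B) (f1 : end1 B) : sum_space B :=
  SumSpace (asboolT (ex_intro _ f0 (ex_intro _ f1 erefl))).

Lemma sum_mkP (v : sum_space B) : exists p, v = sum_mk p.1 p.2.
Proof. by have [f0 [f1 E]] := sum_valP v; exists (f0, f1); apply: val_inj. Qed.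

Definition sum_dec (v : sum_space B) : end0 B * end1 B := sval (cid (sum_mkP v)).

Lemma sum_decK v : sum_mk (sum_dec v).1 (sum_dec v).2 = v.
Proof. by rewrite /sum_dec; case: cid. Qed.

End ComplexInterpolation.

Section CoupleOperators.
Context (R : realType) (B C : interp_couple R).

Record couple_op (S0 : end0 B -> end0 C) (S1 : end1 B -> end1 C) : Prop :=
  CoupleOp {
    couple_op0 : bounded_op (@rnorm R _) (@rnorm R _) S0;
    couple_op1 : bounded_op (@rnorm R _) (@rnorm R _) S1;
    couple_op_agree : forall f0 f1,
      emb0 B f0 = emb1 B f1 -> emb0 C (S0 f0) = emb1 C (S1 f1)
  }.

(* The induced operator f0 + f1 |-> S0 f0 + S1 f1, computed on a chosen
   decomposition; see sum_opE for the independence of the choice. *)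
Definition sum_op (S0 : end0 B -> end0 C) (S1 : end1 B -> end1 C)
    (v : sum_space B) : sum_space C :=
  sum_mk (S0 (sum_dec v).1) (S1 (sum_dec v).2).

Section Extension.
Variables (S0 : end0 B -> end0 C) (S1 : end1 B -> end1 C).
Hypothesis HS : couple_op S0 S1.

Let linearopB (X Z : lmodType (Cx R)) (T : X -> Z) : linear T ->
  forall x y, T (x - y) = T x - T y.
Proof. by move=> linT x y; rewrite addrC -scaleN1r linT scaleN1r addrC. Qed.

Lemma sum_opE f0 f1 : sum_op S0 S1 (sum_mk f0 f1) = sum_mk (S0 f0) (S1 f1).
Proof.
apply: val_inj => /=; set v := sum_mk f0 f1.
have [[lin0 _] [lin1 _] agree] := HS.
have /(congr1 (@sum_val R B)) /= E := sum_decK v.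
have /agree/eqP : emb0 B ((sum_dec v).1 - f0) = emb1 B (f1 - (sum_dec v).2).
  by rewrite !linearB /=; apply/eqP; rewrite subr_eq addrAC eq_sym subr_eq E addrC.
rewrite (linearopB lin0) (linearopB lin1) !linearB /= subr_eq addrAC eq_sym subr_eq => /eqP <-.
exact: addrC.
Qed.

Lemma sum_op_linear : linear (sum_op S0 S1).
Proof.
move=> a u v; have [[lin0 _] [lin1 _] _] := HS.
rewrite -{1}(sum_decK u) -{1}(sum_decK v).
have -> : a *: sum_mk (sum_dec u).1 (sum_dec u).2 +
    sum_mk (sum_dec v).1 (sum_dec v).2 =
    sum_mk (a *: (sum_dec u).1 + (sum_dec v).1)
      (a *: (sum_dec u).2 + (sum_dec v).2).
  by apply: val_inj; rewrite /= !linearP /= scalerDr addrACA.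
rewrite sum_opE lin0 lin1.
by apply: val_inj; rewrite /= !linearP /= scalerDr addrACA.
Qed.

Lemma sum_op_bounded : bounded_op (@rnorm R _) (@rnorm R _) (sum_op S0 S1).
Proof.
split; first exact: sum_op_linear.
have [[_ [M0 H0]] [_ [M1 H1]] _] := HS.
pose M := Num.max `|M0| `|M1| + 1.
have M_gt0 : 0 < M by rewrite ltr_pwDr// le_max normr_ge0.
exists M => v; rewrite mulrC -ler_pdivrMr// rnorm_sum [leRHS]rnorm_sum.
apply: le_sum_norm => f0 f1 vE; rewrite ler_pdivrMr//.
have -> : v = sum_mk f0 f1 by apply: val_inj.
rewrite sum_opE; apply: (@le_trans _ _ (rnorm (S0 f0) + rnorm (S1 f1))).
  exact: sum_norm_le.
rewrite mulrDl ![_ * M]mulrC lerD//.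
  apply: (le_trans (H0 _)); rewrite ler_wpM2r ?rnorm_ge0//.
  by apply: (le_trans (ler_norm _)); rewrite ler_wpDr// le_max lexx.
apply: (le_trans (H1 _)); rewrite ler_wpM2r ?rnorm_ge0//.
by apply: (le_trans (ler_norm _)); rewrite ler_wpDr// le_max lexx orbT.
Qed.

Lemma calderon_op F F0 F1 : calderon F F0 F1 ->
  calderon (sum_op S0 S1 \o F) (S0 \o F0) (S1 \o F1).
Proof.
move=> HF; have [b0 b1 agree] := HS; have b := sum_op_bounded.
have lim (X Z : normedModType (Cx R)) (T : X -> Z) (u : R -> X)
    (H : set_system R) (FH : Filter H) :
    bounded_op (@rnorm R _) (@rnorm R _) T ->
    rnorm (u t) @[t --> H] --> (0 : R) ->
    rnorm (T (u t)) @[t --> H] --> (0 : R).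
  move=> [_ [M TM]] u0; apply: (@rnorm_cvg0_le _ _ _ _ _
    (fun t => M * rnorm (u t))) => //.
  by rewrite -[X in _ --> X](mulr0 M); apply: cvgMr.
have lin0 (X Z : lmodType (Cx R)) (T : X -> Z) : linear T -> T 0 = 0.
  by move=> linT; rewrite -{1}(subrr (0 : X)) linearopB// subrr.
have linZ (X Z : lmodType (Cx R)) (T : X -> Z) a x : linear T ->
    T (a *: x) = a *: T x.
  by move=> linT; rewrite -[a *: x]addr0 linT lin0// addr0.
split.
- have [M FM] := calderon_bounded HF; have [_ [N TN]] := b.
  exists (`|N| * M) => z zS; apply: (le_trans (TN _)).
  apply: (@le_trans _ _ (`|N| * rnorm (F z))).
    by rewrite ler_wpM2r ?rnorm_ge0// ler_norm.
  by rewrite ler_wpM2l ?FM.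
- move=> z U /(bounded_op_continuous b); exact: (calderon_continuous HF).
- move=> z zS; have := calderon_holomorphic HF zS; rewrite /derivable.
  move=> /cvg_ex[/= l Fl]; apply/cvg_ex; exists (sum_op S0 S1 l).
  have [linS _] := b.
  have -> : (fun h : Cx R => h^-1 *: ((sum_op S0 S1 \o F) (h *: 1 + z) -
      (sum_op S0 S1 \o F) z)) =
      sum_op S0 S1 \o (fun h : Cx R => h^-1 *: (F (h *: 1 + z) - F z)).
    by apply/funext => h /=; rewrite (linZ _ _ _ _ _ linS) (linearopB linS).
  by move=> U /(bounded_op_continuous b); exact: Fl.
- move=> t; rewrite compE; have -> : F (0 +i* t)%C = sum_mk (F0 t) 0.
    by apply: val_inj; rewrite /= linear0 addr0 (calderon_trace0 HF).
  by rewrite sum_opE /= (lin0 _ _ _ b1.1) linear0 addr0.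
- move=> t; rewrite compE; have -> : F (1 +i* t)%C = sum_mk 0 (F1 t).
    by apply: val_inj; rewrite /= linear0 add0r (calderon_trace1 HF).
  by rewrite sum_opE /= (lin0 _ _ _ b0.1) linear0 add0r.
- move=> t; apply: continuous_comp; first exact: (calderon_trace0_continuous HF).
  exact: bounded_op_continuous b0 _.
- move=> t; apply: continuous_comp; first exact: (calderon_trace1_continuous HF).
  exact: bounded_op_continuous b1 _.
- exact: lim b0 (calderon_trace0_pinfty HF).
- exact: lim b0 (calderon_trace0_ninfty HF).
- exact: lim b1 (calderon_trace1_pinfty HF).
- exact: lim b1 (calderon_trace1_ninfty HF).
Qed.

Lemma interp_op_subproof (theta : R) (f : interp_space B theta) :
  sum_op S0 S1 (interp_val f) \in @interp_pred R C theta.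
Proof.
have [F [F0 [F1 [HF <-]]]] := interp_valP f; apply/asboolP.
by exists (sum_op S0 S1 \o F), (S0 \o F0), (S1 \o F1); split; [exact: calderon_op|].
Qed.

(* The restriction of the induced operator to B_theta -> C_theta. *)
Definition interp_op (theta : R) (f : interp_space B theta) :
    interp_space C theta :=
  InterpSpace (interp_op_subproof f).

End Extension.
End CoupleOperators.

Section Compatible.
Context (R : realType) (d : measure_display) (Omega : measurableType d).
Context (mu : {measure set Omega -> \bar R}) (B : interp_couple R).
Variables (Delta0 : set Omega -> end0 B -> end0 B).
Variables (Delta1 : set Omega -> end1 B -> end1 B).

Record compatible : Prop := Compatible {
  compatible_wide0 : wide_function_space mu Delta0;
  compatible_wide1 : wide_function_space mu Delta1;
  compatible_agree : forall A, measurable A -> forall f0 f1,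
    emb0 B f0 = emb1 B f1 -> emb0 B (Delta0 A f0) = emb1 B (Delta1 A f1)
}.

Lemma compatible_couple_op (hB : compatible) A : measurable A ->
  couple_op (Delta0 A) (Delta1 A).
Proof.
move=> mA; have [w0 w1 agree] := hB; split; last exact: agree.
- split; first exact: (wide_linear w0).
  by have [c _ H] := wide_bounded w0; exists c => f; exact: H.
- split; first exact: (wide_linear w1).
  by have [c _ H] := wide_bounded w1; exists c => f; exact: H.
Qed.

(* Delta_theta, the restriction of Delta0 + Delta1 to B_theta. *)
Definition interp_Delta (hB : compatible) (theta : R) (A : set Omega)
    (f : interp_space B theta) : interp_space B theta :=
  if pselect (measurable A) is left mA
  then interp_op (compatible_couple_op hB mA) f else 0.

Lemma interp_DeltaE (hB : compatible) theta A (f : interp_space B theta) :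
  measurable A ->
  interp_val (interp_Delta hB A f) = sum_op (Delta0 A) (Delta1 A) (interp_val f).
Proof. by move=> mA; rewrite /interp_Delta; case: pselect. Qed.

End Compatible.

(* Main.v *)
Require Import Defs.
From mathcomp Require Import all_boot all_order all_algebra.
From mathcomp Require Import complex.
From mathcomp Require Import all_classical all_reals all_analysis.

Import Order.TTheory GRing.Theory Num.Theory.
Import numFieldNormedType.Exports.

Local Open Scope classical_set_scope.
Local Open Scope ring_scope.

(* Write S = T Delta_A. If F represents f in B_theta, then for every n the
   function z |-> ((1 + theta) / (1 + z))^n S (F z) represents S f in C_theta.
   The scalar factor is 1 at theta, at most (1 + theta)^n in modulus on the line
   Re z = 0, and at most ((1 + theta) / 2)^n < 1 on the line Re z = 1. Hence n
   can be chosen so as to make the values on Re z = 1 small uniformly in A, and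
   then mu A so small that absolute continuity of T : B_0 -> C_0 makes the values
   on Re z = 0 small. *)

(** * Linear maps and their norm bounds *)

Section LinearMaps.
Context {R : realType}.

Lemma linear_fun0 {X Z : lmodType (Cx R)} {T : X -> Z} : linear T -> T 0 = 0.
Proof.
by move=> linT; have := linT (-1) 0 0; rewrite scaler0 addr0 scaleN1r addNr.
Qed.

Lemma linear_funZ {X Z : lmodType (Cx R)} {T : X -> Z} a x :
  linear T -> T (a *: x) = a *: T x.
Proof.
by move=> linT; rewrite -[a *: x]addr0 linT linear_fun0// addr0.
Qed.

Lemma linear_fun_comp {X Y Z : lmodType (Cx R)} {T : Y -> Z} {S : X -> Y} :
  linear T -> linear S -> linear (T \o S).
Proof. by move=> linT linS a x y /=; rewrite linS linT. Qed.

(** [bounded_op] leaves the sign of its constant open; a nonnegative one is wanted for multiplying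
    bounds. *)
Lemma bounded_op_ge0 {X Z : normedModType (Cx R)} {T : X -> Z} :
  bounded_op (@rnorm R X) (@rnorm R Z) T ->
  exists2 M : R, 0 <= M & forall f, rnorm (T f) <= M * rnorm f.
Proof.
move=> [_ [M TM]]; exists `|M| => // f; apply: (le_trans (TM f)).
by rewrite ler_wpM2r ?rnorm_ge0 ?ler_norm.
Qed.

(** By homogeneity: a nonzero [f] is rescaled by [(rnorm f)^-1] into the unit ball over which
    [opnorm] is a supremum. *)
Lemma le_opnorm {X Z : normedModType (Cx R)} {T : X -> Z} {c : R} :
  linear T -> (opnorm (@rnorm R X) (@rnorm R Z) T <= c%:E)%E ->
  forall f, rnorm (T f) <= c * rnorm f.
Proof.
move=> linT Tc f; have [->|f0] := eqVneq f 0.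
  by rewrite linear_fun0// !rnorm0 mulr0.
have rf : 0 < rnorm f.
  rewrite lt_neqAle rnorm_ge0 andbT eq_sym; apply/eqP => /rnorm_eq0 E.
  by rewrite E eqxx in f0.
pose a : Cx R := (((rnorm f)^-1)%:C)%C.
have ra : rnorm a = (rnorm f)^-1.
  rewrite /rnorm /a ger0_norm//.
  by rewrite -(rmorph0 (real_complex R)) lecR invr_ge0 rnorm_ge0.
rewrite -ler_pdivrMr// mulrC -ra -rnormZ -(linear_funZ _ _ linT) -lee_fin.
apply: le_trans Tc; apply: ereal_sup_ubound; exists (a *: f) => //=.
by rewrite rnormZ ra mulVf// gt_eqF.
Qed.

End LinearMaps.

(** * Modulus, vertical lines and the product rule *)

Section ComplexPlane.
Context {R : realType}.
Implicit Types z w : Cx R.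

Lemma rnormM z w : rnorm (z * w : Cx R) = rnorm z * rnorm w.
Proof. exact: rnormZ. Qed.

Lemma rnormX z n : rnorm (z ^+ n : Cx R) = rnorm z ^+ n.
Proof.
elim: n => [|n IH]; first by rewrite !expr0 /rnorm normr1.
by rewrite !exprS rnormM IH.
Qed.

Lemma le_Re_rnorm z : complex.Re z <= rnorm z.
Proof.
apply: (le_trans (ler_norm _)); rewrite -lecR -rnormE.
exact: normc_ge_Re.
Qed.

Lemma imaginary_line_continuous (a : R) :
  continuous (fun t : R => (a +i* t)%C : Cx R).
Proof.
move=> t; apply/cvgrPdist_lt => e e0.
have /complex_realP[r eE] := gtr0_real e0.
have r0 : 0 < r by move: e0; rewrite eE -(rmorph0 (real_complex R)) ltcR.
near=> s.
(* The map is an isometry, as the real parts cancel. *)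
rewrite normc_def /= subrr expr0n /= add0r sqrtr_sqr eE ltcR; near: s.
exact: cvgr_dist_lt.
Unshelve. all: by end_near. Qed.

Lemma derivable_scale {X : normedModType (Cx R)} {p : Cx R -> Cx R}
    {F : Cx R -> X} {z} :
  derivable p z 1 -> derivable F z 1 -> derivable (fun w => p w *: F w) z 1.
Proof.
move=> dp dF.
have cp : p h @[h --> z] --> p z.
  by apply: differentiable_continuous; apply/derivable1_diffP.
move: dp dF => /cvg_ex[/= dp Hp] /cvg_ex[/= dF HF].
apply/cvg_ex; exists (p z *: dF + dp *: F z).
(* Product rule: with [u = h *: 1 + z], insert [p u *: F z]. The first term then needs the
   continuity [cp] of [p] at [z]. *)
have -> : (fun h : Cx R => h^-1 *:
    (p (h *: 1 + z) *: F (h *: 1 + z) - p z *: F z)) =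
  (fun h => p (h *: 1 + z) *: (h^-1 *: (F (h *: 1 + z) - F z)) +
    (h^-1 *: (p (h *: 1 + z) - p z)) *: F z).
  apply/funext => h; set u := h *: 1 + z.
  transitivity (h^-1 *: (p u *: (F u - F z) + (p u - p z) *: F z)).
    by congr (_ *: _); rewrite scalerBr scalerBl addrA subrK.
  by rewrite scalerDr scalerA mulrC -scalerA [X in _ + X]scalerA.
apply: cvgD; last exact: cvgZr_tmp Hp.
have : (h *: 1 + z : Cx R) @[h --> (0 : Cx R)^'] --> (0 *: 1 + z : Cx R).
  apply: cvgD; last exact: cvg_cst.
  by apply: cvgZr_tmp; exact: cvg_within.
rewrite scale0r add0r => hz.
exact: cvgZ (cvg_comp _ _ hz cp) HF.
Qed.

End ComplexPlane.

(** * Norms and scalar multipliers on the Calderon space *)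

Section Calderon.
Context {R : realType} {B : interp_couple R}.

Lemma calderon_norm_le (F0 : R -> end0 B) (F1 : R -> end1 B) (c : R) :
  (forall t, rnorm (F0 t) <= c) -> (forall t, rnorm (F1 t) <= c) ->
  calderon_norm F0 F1 <= c.
Proof.
move=> F0c F1c; rewrite /calderon_norm ge_max; apply/andP; split.
  by apply: ge_sup => [|_ [t _ <-]//]; exists (rnorm (F0 0)), 0.
by apply: ge_sup => [|_ [t _ <-]//]; exists (rnorm (F1 0)), 0.
Qed.

(** A real [sup] dominates its set only if the set is bounded; continuity and decay at infinity
    ensure this. *)
Lemma le_calderon_norm {F F0 F1} : @calderon R B F F0 F1 ->
  (forall t, rnorm (F0 t) <= calderon_norm F0 F1) /\
  (forall t, rnorm (F1 t) <= calderon_norm F0 F1).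
Proof.
move=> HF; split=> t; rewrite /calderon_norm le_max; apply/orP.
  left; apply: ub_le_sup; last by exists t.
  by have [] := has_sup_rnorm (calderon_trace0_continuous HF)
    (calderon_trace0_pinfty HF) (calderon_trace0_ninfty HF).
right; apply: ub_le_sup; last by exists t.
by have [] := has_sup_rnorm (calderon_trace1_continuous HF)
  (calderon_trace1_pinfty HF) (calderon_trace1_ninfty HF).
Qed.

Lemma interp_norm_le {theta : R} (f : interp_space B theta) {F F0 F1} :
  calderon F F0 F1 -> F (theta%:C)%C = interp_val f ->
  interp_norm f <= calderon_norm F0 F1.
Proof.
move=> HF Ff; apply: ge_inf; last by exists F, F0, F1.
(* The real [inf] needs a lower bound of the set: 0 is one. *)
exists 0 => _ [G [G0 [G1 [HG _ ->]]]].
by have [G0n _] := le_calderon_norm HG; apply: le_trans (G0n 0); exact: rnorm_ge0.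
Qed.

Lemma le_interp_norm {theta : R} (f : interp_space B theta) (c : R) :
  (forall F F0 F1, calderon F F0 F1 -> F (theta%:C)%C = interp_val f ->
    c <= calderon_norm F0 F1) -> c <= interp_norm f.
Proof.
move=> H; apply: lb_le_inf; last by move=> _ [F [F0 [F1 [HF Ff ->]]]]; exact: H Ff.
have [F [F0 [F1 [HF Ff]]]] := interp_valP f.
by exists (calderon_norm F0 F1), F, F0, F1.
Qed.

(** Differentiability of [p] gives holomorphy inside and continuity up to the boundary; the bound
    [K] preserves boundedness and the decay of the traces. *)
Lemma calderon_scale {p : Cx R -> Cx R} {K : R} {F F0 F1} :
  (forall z : Cx R, 0 <= complex.Re z <= 1 -> derivable p z 1) ->
  (forall z : Cx R, 0 <= complex.Re z <= 1 -> rnorm (p z) <= K) ->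
  @calderon R B F F0 F1 ->
  calderon (fun z => p z *: F z) (fun t => p (0 +i* t)%C *: F0 t)
    (fun t => p (1 +i* t)%C *: F1 t).
Proof.
move=> dp pK HF.
have cp (z : Cx R) : 0 <= complex.Re z <= 1 -> {for z, continuous p}.
  by move=> /dp zS; apply: differentiable_continuous; apply/derivable1_diffP.
have S0 t : 0 <= complex.Re (0 +i* t : R[i])%C <= 1 by rewrite /= lexx ler01.
have S1 t : 0 <= complex.Re (1 +i* t : R[i])%C <= 1 by rewrite /= lexx ler01.
have cline (X : normedModType (Cx R)) (a : R) (u : R -> X) :
    (forall t, 0 <= complex.Re (a +i* t : R[i])%C <= 1) -> continuous u ->
    continuous (fun t => p (a +i* t)%C *: u t).
  move=> Sa cu t; apply: cvgZ; last exact: cu.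
  exact: cvg_comp (@imaginary_line_continuous R a t) (cp _ (Sa t)).
have lim (X : normedModType (Cx R)) (a : R) (u : R -> X) (H : set_system R)
    (FH : Filter H) : (forall t, 0 <= complex.Re (a +i* t : R[i])%C <= 1) ->
    rnorm (u t) @[t --> H] --> (0 : R) ->
    rnorm (p (a +i* t)%C *: u t) @[t --> H] --> (0 : R).
  move=> Sa u0; apply: (@rnorm_cvg0_le _ _ _ _ _ (fun t => K * rnorm (u t))).
    by move=> t; rewrite rnormZ ler_wpM2r ?rnorm_ge0 ?pK.
  by rewrite -[X in _ --> X](mulr0 K); apply: cvgMl_tmp.
split.
- have [M FM] := calderon_bounded HF; exists (K * M) => z zS.
  by rewrite rnormZ ler_pM ?rnorm_ge0 ?pK ?FM.
- apply/subspace_continuousP => z zS.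
  have /subspace_continuousP cF := calderon_continuous HF.
  apply: cvgZ; last exact: cF.
  by apply: cvg_trans (cp z zS); apply: cvg_app; exact: cvg_within.
- move=> z /andP[z0 z1]; apply: derivable_scale.
    by apply: dp; rewrite !ltW.
  by apply: (calderon_holomorphic HF); rewrite z0.
- by move=> t; rewrite linearZ /= -(calderon_trace0 HF).
- by move=> t; rewrite linearZ /= -(calderon_trace1 HF).
- exact: cline (calderon_trace0_continuous HF).
- exact: cline (calderon_trace1_continuous HF).
- exact: lim (calderon_trace0_pinfty HF).
- exact: lim (calderon_trace0_ninfty HF).
- exact: lim (calderon_trace1_pinfty HF).
- exact: lim (calderon_trace1_ninfty HF).
Qed.

End Calderon.

(** * The scalar weight *)

Section Weight.
Context {R : realType}.

(** A rational substitute for the exponential weight [exp (n (theta - z))]; its only possible pole,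
    -1, lies off the strip. *)
Definition weight (theta : R) (n : nat) (z : Cx R) : Cx R :=
  (((1 + theta)%:C)%C * (1 + z)^-1) ^+ n.

Lemma weight_theta (theta : R) n : 0 < theta -> weight theta n (theta%:C)%C = 1.
Proof.
move=> t0; rewrite /weight rmorphD /= rmorph1 mulfV ?expr1n//.
rewrite -(rmorph1 (real_complex R)) -rmorphD /= -(rmorph0 (real_complex R)).
by apply/eqP => /complexI /eqP; rewrite gt_eqF// addr_gt0.
Qed.

Lemma Re_add1_le (z : Cx R) : 1 + complex.Re z <= rnorm (1 + z : Cx R).
Proof. by case: z => a b; exact: (le_Re_rnorm (1 + (a +i* b)%C)). Qed.

(** Follows from [|1 + z| >= 1 + Re z >= 1 + a]. The case [a = 0] serves the whole strip, [a = 1]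
    the right boundary line. *)
Lemma rnorm_weight_le (theta : R) n (z : Cx R) (a : R) :
  0 < theta -> 0 <= a <= complex.Re z ->
  rnorm (weight theta n z) <= ((1 + theta) / (1 + a)) ^+ n.
Proof.
move=> t0 /andP[a0 az]; rewrite /weight rnormX lerXn2r ?nnegrE ?rnorm_ge0//.
  by rewrite divr_ge0// addr_ge0// ltW.
have z1 : 0 < 1 + a by rewrite ltr_pwDl.
have za : 1 + a <= rnorm (1 + z : Cx R).
  by apply: le_trans (Re_add1_le z); rewrite lerD2l.
have zr := lt_le_trans z1 za.
have zn0 : 1 + z != 0.
  by apply/eqP => E; move: zr; rewrite E rnorm0 ltxx.
have -> : rnorm (((1 + theta)%:C)%C * (1 + z)^-1 : Cx R) =
    (1 + theta) / rnorm (1 + z : Cx R).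
  (* Multiplying back by [|1 + z|] removes the inverse, as [rnorm] is multiplicative. *)
  rewrite -[LHS](mulfK (lt0r_neq0 zr)); congr (_ / _).
  rewrite -rnormM mulfVK// /rnorm ger0_norm//.
  by rewrite -(rmorph0 (real_complex R)) lecR addr_ge0// ltW.
by rewrite ler_wpM2l ?lef_pV2 ?posrE// addr_ge0// ltW.
Qed.

Lemma derivable_weight (theta : R) n (z : Cx R) :
  0 <= complex.Re z -> derivable (weight theta n) z 1.
Proof.
move=> z0.
have -> : weight theta n =
    (fun w : Cx R => ((1 + theta)%:C)%C * (1 + w)^-1 : Cx R) ^+ n.
  by rewrite exprfctE.
apply: derivableX; apply: derivableM; first exact: derivable_cst.
apply: derivableV; last by apply: derivableD; [exact: derivable_cst|exact: derivable_id].
apply/eqP => E; have := Re_add1_le z; rewrite E rnorm0 leNgt.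
by rewrite ltr_pwDl.
Qed.

End Weight.

(** * Weighted bounds for interpolated operators *)

Section InterpolatedOperators.
Context {R : realType} {B C : interp_couple R}.

Lemma interp_op_linear {S0 S1} (HS : @couple_op R B C S0 S1) theta :
  linear (interp_op HS (theta := theta)).
Proof. by move=> a f g; apply: val_inj; rewrite /= (sum_op_linear HS). Qed.

(** The quantitative core: the weighted image of a representative of [f] represents the image of
    [f], and [n] trades a larger factor on [M0] for a smaller one on [M1]. *)
Lemma interp_norm_op_le {S0 S1} (HS : @couple_op R B C S0 S1) (theta : R)
    (n : nat) (M0 M1 c : R) (f : interp_space B theta) :
  0 < theta -> 0 < c ->
  (forall f, rnorm (S0 f) <= M0 * rnorm f) ->
  (forall f, rnorm (S1 f) <= M1 * rnorm f) ->
  (1 + theta) ^+ n * M0 <= c -> ((1 + theta) / 2) ^+ n * M1 <= c ->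
  interp_norm (interp_op HS f) <= c * interp_norm f.
Proof.
move=> t0 c0 SM0 SM1 c_ge0 c_ge1.
(* Dividing by [c > 0] reduces the bound to one for each representative [F]. *)
rewrite mulrC -ler_pdivrMr//; apply: le_interp_norm => F F0 F1 HF Ff.
rewrite ler_pdivrMr// mulrC.
have wK (z : Cx R) : 0 <= complex.Re z <= 1 ->
    rnorm (weight theta n z) <= ((1 + theta) / (1 + 0)) ^+ n.
  by move=> /andP[z0 _]; apply: rnorm_weight_le; rewrite ?lexx.
have dw (z : Cx R) : 0 <= complex.Re z <= 1 -> derivable (weight theta n) z 1.
  by move=> /andP[z0 _]; exact: derivable_weight.
have HG := calderon_scale dw wK (calderon_op HS HF).
have [F0n F1n] := le_calderon_norm HF.
have bnd (X Z : normedModType (Cx R)) (S : X -> Z) (x : X) (z : Cx R)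
    (a M N : R) : (forall x, rnorm (S x) <= M * rnorm x) ->
    rnorm (weight theta n z) <= a -> a * M <= c -> rnorm x <= N ->
    rnorm (weight theta n z *: S x) <= c * N.
  move=> SM wa aM xN; rewrite rnormZ.
  have a0 : 0 <= a by apply: le_trans wa; exact: rnorm_ge0.
  apply: (@le_trans _ _ (a * (M * rnorm x))).
    by rewrite ler_pM ?rnorm_ge0.
  rewrite mulrA; apply: (@le_trans _ _ (c * rnorm x)).
    by rewrite ler_wpM2r ?rnorm_ge0.
  by rewrite ler_wpM2l// ltW.
apply: (le_trans (interp_norm_le _ HG _)).
  by rewrite weight_theta// scale1r /= Ff.
apply: calderon_norm_le => t /=.
  apply: bnd c_ge0 (F0n t) => //.
  by rewrite -[1 + theta]divr1 -[X in _ / X]addr0 rnorm_weight_le /= ?lexx.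
apply: bnd c_ge1 (F1n t) => //.
by apply: rnorm_weight_le => //=; rewrite ler01 lexx.
Qed.

Lemma couple_op_comp {D : interp_couple R} {S0 S1 T0 T1} :
  @couple_op R B C S0 S1 -> @couple_op R C D T0 T1 ->
  couple_op (T0 \o S0) (T1 \o S1).
Proof.
have comp (X Y Z : normedModType (Cx R)) (S : X -> Y) (T : Y -> Z) :
    bounded_op (@rnorm R _) (@rnorm R _) S ->
    bounded_op (@rnorm R _) (@rnorm R _) T ->
    bounded_op (@rnorm R _) (@rnorm R _) (T \o S).
  move=> [linS [M SM]] bT; have [N N0 TN] := bounded_op_ge0 bT.
  split; first exact: linear_fun_comp bT.1 linS.
  exists (N * M) => f /=; apply: (le_trans (TN _)).
  by rewrite -mulrA ler_wpM2l.
move=> [S0b S1b Sa] [T0b T1b Ta]; split; [exact: comp|exact: comp|].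
by move=> f0 f1 /Sa /Ta.
Qed.

(** The outer operator may choose another decomposition than the inner one produced; [sum_opE] makes
    this harmless. *)
Lemma sum_op_comp {D : interp_couple R} (S0 : end0 B -> end0 C)
    (S1 : end1 B -> end1 C) {T0 T1} (v : sum_space B) :
  @couple_op R C D T0 T1 ->
  sum_op T0 T1 (sum_op S0 S1 v) = sum_op (T0 \o S0) (T1 \o S1) v.
Proof. by move=> HT; exact: sum_opE. Qed.

End InterpolatedOperators.

(** * Choice of the constants for absolute continuity *)

Theorem proposition13 (R : realType) (d : measure_display)
    (Omega : measurableType d) (mu : {measure set Omega -> \bar R})
    (B C : interp_couple R)
    (Delta0 : set Omega -> end0 B -> end0 B)
    (Delta1 : set Omega -> end1 B -> end1 B)
    (Delta2 : set Omega -> end0 C -> end0 C)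
    (Delta3 : set Omega -> end1 C -> end1 C)
    (compatB : compatible mu Delta0 Delta1)
    (compatC : compatible mu Delta2 Delta3)
    (theta : R) (theta01 : 0 < theta < 1)
    (T0 : end0 B -> end0 C) (T1 : end1 B -> end1 C)
    (opT : couple_op T0 T1) :
  absolutely_continuous mu (@rnorm R (end0 B)) (@rnorm R (end0 C)) Delta0 T0 ->
  absolutely_continuous mu
    (@interp_norm R B theta) (@interp_norm R C theta)
    (interp_Delta compatB (theta := theta)) (interp_op opT (theta := theta)).
Proof.
move=> [_ acT]; have /andP[theta0 theta1] := theta01.
have [M0 M00 TM0] := bounded_op_ge0 (couple_op0 opT).
have [M1 M10 TM1] := bounded_op_ge0 (couple_op1 opT).
split.
  split; first exact: interp_op_linear.
  (* Boundedness is the unweighted case [n = 0]; the summand 1 makes the constant positive. *)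
  exists (M0 + M1 + 1) => f.
  apply: (interp_norm_op_le opT theta 0 M0 M1) => //.
  - by rewrite ltr_wpDl// addr_ge0.
  - by rewrite expr0 mul1r -addrA lerDl addr_ge0.
  - by rewrite expr0 mul1r addrAC lerDr addr_ge0.
move=> eps eps0.
(* [K] bounds [Delta1 A] uniformly in [A], so [n] can be fixed before [A]. *)
have [K K0 DK] := wide_bounded (compatible_wide1 compatB).
have e2 : 0 < eps / 2 by rewrite divr_gt0.
have [n nP] : exists n, ((1 + theta) / 2) ^+ n * (M1 * K) <= eps / 2.
  have q1 : `|(1 + theta) / 2| < 1.
    rewrite ger0_norm; last by rewrite divr_ge0// addr_ge0// ltW.
    by rewrite ltr_pdivrMr// mul1r -[ltRHS]/(1 + 1) ltrD2l.
  have [n _ nP] := cvgr0_norm_lt _ (cvg_geometric (M1 * K) q1) _ e2.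
  exists n; rewrite mulrC ltW//; apply: le_lt_trans (nP n (leqnn n)).
  exact: ler_norm.
(* Chosen so that the factor [(1 + theta) ^+ n] on the left line restores exactly [eps / 2]. *)
pose eta := eps / 2 / (1 + theta) ^+ n.
have t1n : 0 < (1 + theta) ^+ n by rewrite exprn_gt0// addr_gt0.
have eta0 : 0 < eta by rewrite divr_gt0.
have [delta delta0 deltaP] := acT _ eta0; exists delta => // A mA Adelta.
have HD := compatible_couple_op compatB mA.
have HS := couple_op_comp HD opT.
(* A supremum inherits only a weak inequality; aiming at [eps / 2] keeps the final one strict. *)
apply: (@le_lt_trans _ _ (eps / 2)%:E); last first.
  by rewrite lte_fin ltr_pdivrMr// ltr_pMr// ltr1n.
apply: ge_ereal_sup => _ [f /= f1 <-]; rewrite lee_fin.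
(* Seen as one couple operator, [T Delta_A] falls under the weighted bound. *)
have -> : interp_op opT (interp_Delta compatB A f) = interp_op HS f.
  by apply: val_inj; rewrite /= interp_DeltaE// (sum_op_comp _ _ _ opT).
apply: (@le_trans _ _ (eps / 2 * interp_norm f)); last first.
  by rewrite -[leRHS]mulr1 ler_wpM2l// ltW.
apply: (interp_norm_op_le HS theta n eta (M1 * K)) => //.
- apply: le_opnorm (ltW (deltaP A mA Adelta)).
  exact: linear_fun_comp (couple_op0 opT).1 (couple_op0 HD).1.
- move=> g /=; apply: (le_trans (TM1 _)); rewrite -mulrA ler_wpM2l//.
  exact: DK.
- by rewrite /eta mulrC divfK// gt_eqF.
Qed.
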